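(* Let $0<R<\frac{\pi}{2}$ and $\mathcal{B}_R=\{(\cos\theta,\sin\theta)\in S^1\mid|\theta|\le R\}$. Then any $\eta$-martingale on $S^1\subset\mathbb{R}^2$ with values in $\mathcal{B}_R$ converges almost surely in $\mathcal{B}_R$ as $t\to\infty$.
   Context: A filtered probability space $(\Omega,\mathcal{F},\{\mathcal{F}_t\}_{t\ge0},\mathbb{P})$ satisfying the usual hypotheses is fixed. $M=S^1=\{(x^1,x^2)\in\mathbb{R}^2:(x^1)^2+(x^2)^2=1\}$. An $M$-valued process $X$ is an $M$-valued semimartingale if $f(X)$ is a real-valued càdlàg semimartingale for every $f\in C^\infty(M)$. The connection rule $\eta$ on $M$ is $\eta(x,y)=\Pi_x(y-x)$, where $\Pi_x:\mathbb{R}^2\to T_xM$ is the orthogonal projection. Itô integral: let $\phi$ be a càdlàg adapted $T^*M$-valued process above $X$, i.e. $\phi_t\in T^*_{X_t}M$ for all $t$. Then $\int\phi_-\,\eta\, dX$ is the càdlàg semimartingale whose value at time $t$ is the limit in probability, as $n\to\infty$, of $\sum_{i=1}^{k_n}\langle\phi_{\tau^n_{i-1}\wedge t},\eta(X_{\tau^n_{i-1}\wedge t},X_{\tau^n_i\wedge t})\rangle$, where $0=\tau^n_0<\tau^n_1<\dots<\tau^n_{k_n}$ are random partitions by stopping times with mesh tending to $0$ and $\tau^n_{k_n}\to\infty$; the limit exists and does not depend on the partitions. $X$ is an $\eta$-martingale if $\int\phi_-\,\eta\,dX$ is a local martingale for every such $\phi$. *)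

(* Defs.v *)
From HB Require Import structures.
From mathcomp Require Export all_boot all_order all_algebra.
From mathcomp Require Export all_classical all_reals all_analysis.

Set Implicit Arguments.
Unset Strict Implicit.
Unset Printing Implicit Defensive.

Import Order.TTheory GRing.Theory Num.Theory.
Import numFieldNormedType.Exports.

Local Open Scope classical_set_scope.
Local Open Scope ring_scope.

(* The time set [0, +oo[ is encoded by R itself: every condition on a process
   or on a filtration is imposed at nonnegative times only, and the values at
   negative times are irrelevant. *)

Section Processes.
Context {R : realType} {d : measure_display} {Omega : measurableType d}.
Variables (P : probability Omega R) (F : R -> set (set Omega)).

(* The last two conditions are the usual hypotheses. As F 0 consists of
   measurable sets, the last one also says that P is complete. *)
Definition usual_filtration : Prop :=
  [/\ forall t, 0 <= t -> sigma_algebra setT (F t) /\ F t `<=` measurable,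
      forall s t, 0 <= s -> s <= t -> F s `<=` F t,
      forall t, 0 <= t -> \bigcap_(s in `]t, +oo[) F s `<=` F t
    & forall N, P.-negligible N -> F 0 N].

Definition adapted d' (U : measurableType d') (X : R -> Omega -> U) : Prop :=
  forall t, 0 <= t -> forall B, measurable B -> F t (X t @^-1` B).

Definition cadlag (U : topologicalType) (X : R -> Omega -> U) : Prop :=
  forall omega,
    (forall t, 0 <= t -> X s omega @[s --> t^'+] --> X t omega) /\
    (forall t, 0 < t -> exists l : U, X s omega @[s --> t^'-] --> l).

Definition stopping_time (T : Omega -> \bar R) : Prop :=
  (forall omega, (0 <= T omega)%E) /\
  (forall t, 0 <= t -> F t [set omega | (T omega <= t%:E)%E]).

Definition stopped (X : R -> Omega -> R) (T : Omega -> \bar R) :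
    R -> Omega -> R :=
  fun t omega => X (fine (Order.min t%:E (T omega))) omega.

(* The equality of integrals over all events A in F s is E[X_t | F_s] = X_s. *)
Definition martingale (X : R -> Omega -> R) : Prop :=
  [/\ adapted X,
      forall t, 0 <= t -> P.-integrable setT (EFin \o X t)
    & forall s t, 0 <= s -> s <= t -> forall A, F s A ->
        (\int[P]_(omega in A) (X t omega)%:E =
         \int[P]_(omega in A) (X s omega)%:E)%E].

(* As X_0 need not be integrable, it is X - X_0 that is localised. *)
Definition local_martingale (X : R -> Omega -> R) : Prop :=
  [/\ adapted X, cadlag X
    & exists T : nat -> Omega -> \bar R,
      [/\ forall n, stopping_time (T n),
          {ae P, forall omega, forall n, (T n omega <= T n.+1 omega)%E},
          {ae P, forall omega, T n omega @[n --> \oo] --> +oo%E}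
        & forall n, martingale
            (fun t omega => stopped X (T n) t omega - X 0 omega)]].

Definition finite_variation_process (A : R -> Omega -> R) : Prop :=
  [/\ adapted A, cadlag A
    & forall omega t, 0 <= t -> bounded_variation 0 t (A ^~ omega)].

Definition semimartingale (X : R -> Omega -> R) : Prop :=
  [/\ adapted X, cadlag X
    & exists M A : R -> Omega -> R,
      [/\ local_martingale M, finite_variation_process A,
          forall omega, M 0 omega = 0 /\ A 0 omega = 0
        & forall t omega, 0 <= t ->
            X t omega = X 0 omega + M t omega + A t omega]].

Definition cvg_in_probability (Y : nat -> Omega -> R) (Z : Omega -> R) : Prop :=
  forall e : R, 0 < e ->
    P [set omega | e <= `|Y n omega - Z omega|] @[n --> \oo] --> 0%E.

Definition random_partitions (k : nat -> nat) (tau : nat -> nat -> Omega -> R) :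
    Prop :=
  [/\ forall n i, (i <= k n)%N -> stopping_time (EFin \o tau n i),
      forall n omega, tau n 0%N omega = 0,
      forall n i omega, (i < k n)%N -> tau n i omega < tau n i.+1 omega,
      {ae P, forall omega,
        \big[Num.max/0]_(i < k n) (tau n i.+1 omega - tau n i omega)
          @[n --> \oo] --> (0 : R)}
    & {ae P, forall omega, tau n (k n) omega @[n --> \oo] --> +oo%R}].

End Processes.

Section Circle.
Context {R : realType}.

Definition dot (u v : R * R) : R := u.1 * v.1 + u.2 * v.2.

Definition circle : set (R * R) := [set x | x.1 ^+ 2 + x.2 ^+ 2 = 1].

(* f is of class C^oo on the circle (its values elsewhere are irrelevant): it is
   smooth in the angular charts, which are the local inverses of
   theta |-> (cos theta, sin theta). *)
Definition smooth_on_circle (f : R * R -> R) : Prop :=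
  forall (n : nat) (theta : R),
    derivable (derive1n n (fun a : R => f (cos a, sin a))) theta 1.

Definition tangent (x : R * R) : set (R * R) := [set v | dot x v = 0].

(* A linear form on the tangent line at x is <p, .> for exactly one tangent
   vector p at x. The cotangent space is represented by these p, and the
   cotangent bundle by the pairs (x, p), as a subspace of R^2 * R^2. *)
Definition cotangent (x : R * R) : set (R * R) := tangent x.
Definition pairing (p v : R * R) : R := dot p v.

(* The orthogonal projection onto tangent x, for x a unit vector. *)
Definition proj_tangent (x v : R * R) : R * R :=
  (v.1 - dot x v * x.1, v.2 - dot x v * x.2).

Definition eta (x y : R * R) : R * R :=
  proj_tangent x (y.1 - x.1, y.2 - x.2).

Definition circle_arc (r : R) : set (R * R) :=
  [set x | exists theta : R, `|theta| <= r /\ x = (cos theta, sin theta)].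

End Circle.

Section EtaMartingales.
Context {R : realType} {d : measure_display} {Omega : measurableType d}.
Variables (P : probability Omega R) (F : R -> set (set Omega)).
Implicit Types X phi : R -> Omega -> R * R.

Definition circle_semimartingale X : Prop :=
  (forall t omega, 0 <= t -> circle (X t omega)) /\
  (forall f, smooth_on_circle f ->
    semimartingale P F (fun t omega => f (X t omega))).

Definition cotangent_process_above X phi : Prop :=
  [/\ forall t omega, 0 <= t -> cotangent (X t omega) (phi t omega),
      adapted F phi & cadlag phi].

Definition eta_sum X phi (m : nat) (tau : nat -> Omega -> R) (t : R)
    (omega : Omega) : R :=
  \sum_(i < m)
    pairing (phi (Num.min (tau i omega) t) omega)
      (eta (X (Num.min (tau i omega) t) omega)
           (X (Num.min (tau i.+1 omega) t) omega)).

(* I is a version of the integral of phi_- against eta dX. *)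
Definition is_eta_integral X phi (I : R -> Omega -> R) : Prop :=
  semimartingale P F I /\
  forall (k : nat -> nat) (tau : nat -> nat -> Omega -> R),
    random_partitions P F k tau ->
    forall t, 0 <= t ->
      cvg_in_probability P (fun n => eta_sum X phi (k n) (tau n) t) (I t).

(* The integral is determined up to indistinguishability, so it does not matter
   which version is taken. *)
Definition eta_martingale X : Prop :=
  circle_semimartingale X /\
  forall phi, cotangent_process_above X phi ->
    exists I, is_eta_integral X phi I /\ local_martingale P F I.

End EtaMartingales.

(* Main.v *)
Require Import Defs.
From mathcomp Require Import all_boot all_order all_algebra.
From mathcomp Require Import all_classical all_reals all_analysis.
From mathcomp Require Import measurable_realfun ring lra.
Set Implicit Arguments.
Unset Strict Implicit.
Unset Printing Implicit Defensive.
Import Order.TTheory GRing.Theory Num.Theory.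
Import numFieldNormedType.Exports.
Local Open Scope classical_set_scope.
Local Open Scope ring_scope.

(** Let [b] be a unit vector making an angle at most [pi / 2] with every point of
    the arc, and let [S] be the process [dot b (X t)], which takes its values in
    [[0, 1]]. Let [phi] be the opposite of the gradient of [dot b] on the circle,
    along [X]. For points [x] and [y] of the arc, the difference between
    [dot b x - dot b y] and the pairing of [phi] with [eta x y] is
    [dot b x * (1 - dot x y)], which is nonnegative
    ([pairing_descent_eta_le]). Summing over partitions and passing to the limit,
    the increments of the integral [I] of [phi] against [eta dX] are at most those
    of [- S] ([integral_increments_le_ae]). As [I] is a local martingale and [S]
    is bounded, [S] is a supermartingale
    ([supermartingale_of_local_martingale]), and Doob's upcrossing inequality
    makes it converge almost surely ([supermartingale_cvg_ae]).

    As the radius of the arc is less than [pi / 2], there is room for two linearly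
    independent choices of [b], symmetric about the middle of the arc. The
    convergence of the two processes [S] is that of the two coordinates of [X],
    and the arc is closed. *)

(** * Upcrossings of a sequence *)

Section Upcrossings.
Context {R : realType}.
Variables (a b : R).
Implicit Type x : nat -> R.

(** The position held by a trader who buys when the price is below [a] and sells
    once it exceeds [b]. *)
Fixpoint holding x (k : nat) : bool :=
  if k is j.+1 then (if holding x j then x j.+1 <= b else x j.+1 < a)
  else x 0%N < a.

(** The number of completed sales, hence of upcrossings of [[a, b]], up to
    time [k]. *)
Fixpoint upcrossings x (k : nat) : nat :=
  if k is j.+1 then (upcrossings x j + (holding x j && (b < x j.+1)%R))%N
  else 0%N.

Definition trading_gain x (n : nat) : R :=
  \sum_(k < n) (if holding x k then x k.+1 - x k else 0).

(** Each sale earns at least [b - a]; the only possible loss is on the position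
    still open at time [n], bought below [a]. *)
Lemma upcrossings_le_trading_gain x n :
  (upcrossings x n)%:R * (b - a) + (if holding x n then x n - a else 0)
    <= trading_gain x n.
Proof.
rewrite /trading_gain; elim: n => [|n IHn].
  by rewrite big_ord0 /=; case: ltP => ?; lra.
rewrite big_ord_recr /= natrD mulrDl.
move: IHn; set u := _%:R * _; set g := bigop _ _ _.
case: (holding x n) => /=; last by rewrite mul0r; case: ltP; lra.
by case: leP => ? /=; rewrite ?mul0r ?mul1r; lra.
Qed.

Lemma upcrossings_mono x : {homo upcrossings x : i j / (i <= j)%N}.
Proof.
move=> i j /subnKC <-; elim: (j - i)%N => [|m IHm]; first by rewrite addn0.
by rewrite addnS (leq_trans IHm)// leq_addr.
Qed.

Lemma holding_below x k : a < b -> x k < a -> holding x k.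
Proof.
move=> ab; case: k => [//|k] xa /=.
by case: (holding x k) => //; apply: ltW; apply: lt_trans ab.
Qed.

(** An open position is sold at the latest when the price exceeds [b]. *)
Lemma upcrossings_lt x i j :
  holding x i -> (i < j)%N -> b < x j -> (upcrossings x i < upcrossings x j)%N.
Proof.
move=> + /subnKC <-; move: (j - i.+1)%N => m; elim: m i => [|m IHm] i Hi.
  by rewrite addn0 /= Hi => -> ; rewrite addn1.
rewrite -addSnnS => bx.
have [Hi1|] := boolP (holding x i.+1).
  by apply: leq_ltn_trans (IHm _ Hi1 bx); apply: upcrossings_mono.
rewrite [holding _ _]/= Hi -ltNge => bxi.
suff: (upcrossings x i < upcrossings x i.+1)%N.
  move=> /leq_trans; apply; apply: upcrossings_mono.
  by rewrite !addSn ltnS leqW ?leq_addr.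
by rewrite /= Hi bxi addn1.
Qed.

End Upcrossings.

(** * Bounded supermartingales in discrete time *)

(** Measurability with respect to a sigma-algebra [G] of events is measurability
    on the measurable space [g_sigma_algebraType G]; this gives access to the
    closure properties of measurable functions. *)
Lemma measurable_fun_sigma_algebra d' (T : pointedType) (U : measurableType d')
    (G : set (set T)) (f : T -> U) :
  sigma_algebra setT G ->
  measurable_fun setT (f : g_sigma_algebraType G -> U) <->
  forall B, measurable B -> G (f @^-1` B).
Proof.
move=> sG; have GE : @measurable _ (g_sigma_algebraType G) = G.
  exact: sigma_algebra_id.
split=> [mf B mB|mf _ B mB].
  by have := mf measurableT B mB; rewrite setTI GE.
by rewrite setTI GE; exact: mf.
Qed.

Lemma measurable_holding {R : realType} d (T : measurableType d) (a b : R)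
    (Y : nat -> T -> R) (k : nat) :
  (forall j, (j <= k)%N -> measurable_fun setT (Y j)) ->
  measurable_fun setT (fun w => holding a b (Y^~ w) k).
Proof.
elim: k => [|k IHk] mY /=.
  by apply: measurable_fun_ltr => //; exact: mY.
apply: measurable_fun_ifT.
- by apply: IHk => j jk; apply: mY; exact: leqW.
- by apply: measurable_fun_ler => //; exact: mY.
- by apply: measurable_fun_ltr => //; exact: mY.
Qed.

Lemma measurable_upcrossings {R : realType} d (T : measurableType d) (a b : R)
    (Y : nat -> T -> R) (k : nat) :
  (forall j, measurable_fun setT (Y j)) ->
  measurable_fun setT (fun w => (upcrossings a b (Y^~ w) k)%:R : R).
Proof.
move=> mY; elim: k => [|k IHk] /=; first exact: measurable_cst.
under eq_fun do rewrite natrD.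
apply: measurable_funD => //.
rewrite [X in measurable_fun _ X](_ : _ = fun w =>
    if holding a b (Y^~ w) k then (if b < Y k.+1 w then 1 else 0) else 0); last first.
  by apply/funext => w; case: (holding _ _ _ _); case: (b < _).
apply: measurable_fun_ifT.
- exact: measurable_holding.
- apply: measurable_fun_ifT; [|exact: measurable_cst..].
  by apply: measurable_fun_ltr.
- exact: measurable_cst.
Qed.

(** Doob's upcrossing inequality. The gain of the trader is a martingale
    transform, so its expectation is nonpositive, while it is at least [b - a]
    for each upcrossing up to the loss on the last open position, which is at
    most [`|a|] as the prices are nonnegative. *)
Lemma expected_upcrossings_le {R : realType} d (Omega : measurableType d)
    (P : probability Omega R) (G : nat -> set (set Omega)) (Y : nat -> Omega -> R)
    (a b : R) (n : nat) :
  a < b ->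
  (forall k, sigma_algebra setT (G k) /\ G k `<=` measurable) ->
  (forall j k, (j <= k)%N -> G j `<=` G k) ->
  (forall k B, measurable B -> G k (Y k @^-1` B)) ->
  (forall k w, 0 <= Y k w <= 1) ->
  (forall k A, G k A ->
    (\int[P]_(w in A) (Y k.+1 w)%:E <= \int[P]_(w in A) (Y k w)%:E)%E) ->
  ((b - a)%:E * \int[P]_w (upcrossings a b (Y^~ w) n)%:R%:E <= `|a|%:E)%E.
Proof.
move=> ab sG monoG adY Y01 superY.
have mY k : measurable_fun setT (Y k).
  by move=> _ B mB; rewrite setTI; apply: (sG k).2; exact: adY.
pose held k j w := if holding a b (Y^~ w) k then Y j w else 0.
have held0 k j w : 0 <= held k j w.
  by rewrite /held; case: ifP => // _; case/andP: (Y01 j w).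
have held1 k j w : held k j w <= 1.
  by rewrite /held; case: ifP => // _; case/andP: (Y01 j w).
have mheld k j : measurable_fun setT (held k j).
  by apply: measurable_fun_ifT => //; exact: measurable_holding.
have Gheld k : G k [set w | holding a b (Y^~ w) k].
  have /(measurable_fun_sigma_algebra _ (sG k).1) : measurable_fun setT
      ((fun w => holding a b (Y^~ w) k) : g_sigma_algebraType (G k) -> bool).
    apply: measurable_holding => j jk.
    apply/(measurable_fun_sigma_algebra _ (sG k).1) => B mB.
    by apply: (monoG _ _ jk); exact: adY.
  by move=> /(_ [set true] I); congr (G k _); apply/seteqP; split=> w /=.
have superheld k : (\int[P]_w (held k k.+1 w)%:E <= \int[P]_w (held k k w)%:E)%E.
  suff heldE j : (\int[P]_w (held k j w)%:E =
      \int[P]_(w in [set w | holding a b (Y^~ w) k]) (Y j w)%:E)%E.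
    by rewrite !heldE; exact: superY.
  rewrite [RHS]integral_mkcond; apply: eq_integral => w _.
  rewrite patchE /held; case: ifPn => [h|h]; first by rewrite mem_set.
  by rewrite memNset //=; exact/negP.
have fin_held k j : (\int[P]_w (held k j w)%:E \is a fin_num)%E.
  rewrite ge0_fin_numE; last by apply: integral_ge0 => w _; rewrite lee_fin.
  apply: (@le_lt_trans _ _ (\int[P]_w 1)%E).
    apply: ge0_le_integral => //.
    - by move=> w _; rewrite lee_fin.
    - exact/measurable_EFinP.
    - by move=> w _; rewrite lee_fin.
  rewrite integral_cst// mul1e.
  exact: le_lt_trans (probability_le1 P measurableT) (ltry _).
have ba0 : 0 <= b - a by rewrite subr_ge0 ltW.
have pointwise w : (b - a) * (upcrossings a b (Y^~ w) n)%:R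
    + \sum_(k < n) held k k w <= `|a| + \sum_(k < n) held k k.+1 w.
  have := upcrossings_le_trading_gain a b (Y^~ w) n; rewrite mulrC.
  have -> : trading_gain a b (Y^~ w) n =
      \sum_(k < n) held k k.+1 w - \sum_(k < n) held k k w.
    rewrite -sumrB; apply: eq_bigr => k _; rewrite /held.
    by case: ifP => //; rewrite subrr.
  have := Y01 n w => /andP[]; have := ler_norm a; have := normr_ge0 a.
  by case: ifP; lra.
rewrite -(@leeD2rE _ (\sum_(k < n) \int[P]_w (held k k w)%:E)%E); last first.
  by apply/sum_fin_numP => k _.
apply: (@le_trans _ _
    (`|a|%:E + \sum_(k < n) \int[P]_w (held k k.+1 w)%:E)%E); last first.
  by rewrite leeD2l// lee_sum.
have mU : measurable_fun setT (fun w => (upcrossings a b (Y^~ w) n)%:R : R).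
  exact: measurable_upcrossings.
rewrite -ge0_integralZl_EFin//; [|exact/measurable_EFinP].
rewrite -!ge0_integral_sum//; try (by move=> k; exact/measurable_EFinP);
  try by move=> k w _; rewrite lee_fin.
have {1}-> : `|a|%:E = (\int[P]_w `|a|%:E)%E.
  by rewrite integral_cst// [X in (_ * X)%E](@probability_setT _ _ _ P) mule1.
have msum (j : 'I_n -> nat) :
    measurable_fun setT (fun w => \sum_(k < n) (held k (j k) w)%:E)%E.
  by apply: emeasurable_sum => k; exact/measurable_EFinP.
have sum0 (j : 'I_n -> nat) w : (0 <= \sum_(k < n) (held k (j k) w)%:E)%E.
  by apply: sume_ge0 => k _; rewrite lee_fin.
have U0 w : (0 <= (b - a)%:E * (upcrossings a b (Y^~ w) n)%:R%:E)%E.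
  by rewrite -EFinM lee_fin mulr_ge0.
have mbU : measurable_fun setT
    (fun w => (b - a)%:E * (upcrossings a b (Y^~ w) n)%:R%:E)%E.
  by apply: measurable_funeM; exact/measurable_EFinP.
rewrite -!ge0_integralD//.
apply: ge0_le_integral => //.
- by move=> w _; rewrite adde_ge0.
- exact: emeasurable_funD.
- by apply: emeasurable_funD.
- by move=> w _; rewrite !sumEFin -EFinM -!EFinD lee_fin.
Qed.

(** * Right-continuous paths sampled on dyadic grids *)

Lemma dyadic_in_interval {R : realType} (u e : R) : 0 <= u -> 0 < e ->
  exists p q : nat, u < p%:R / 2 ^+ q /\ p%:R / 2 ^+ q < u + e.
Proof.
move=> u0 e0.
have [q /= _ /(_ q (leqnn q))] := near_infty_natSinv_expn_lt (PosNum e0).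
rewrite /= div1r => qe.
have q0 : 0 < 2 ^+ q :> R by rewrite exprn_gt0.
have /truncn_itv : 0 <= u * 2 ^+ q by rewrite mulr_ge0// ltW.
set p := Num.trunc _ => /andP[pu up].
exists p.+1, q; rewrite ltr_pdivlMr//; split=> //.
by rewrite -natr1 mulrDl div1r ler_ltD// ler_pdivrMr.
Qed.

Definition dyadic_sample {R : realType} (f : R -> R) (n i : nat) : R :=
  f (i%:R / 2 ^+ n).

(** Every grid finer than some fixed one contains the finitely many dyadic times
    that witness [k] successive upcrossings. *)
Lemma dyadic_upcrossings {R : realType} (f : R -> R) (a b : R) (k : nat) :
  a < b ->
  (forall t : R, 0 <= t -> f s @[s --> t^'+] --> f t) ->
  (forall t, exists2 u, t < u & f u < a) ->
  (forall t, exists2 u, t < u & b < f u) ->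
  exists p q : nat, forall n, (q <= n)%N ->
    (k <= upcrossings a b (dyadic_sample f n) (p * 2 ^ (n - q)))%N.
Proof.
move=> ab rc fa fb.
have right_nbhs (Q : R -> Prop) (t : R) : 0 <= t -> (\forall s \near t^'+, Q s) ->
    exists p q : nat, t < p%:R / 2 ^+ q /\ Q (p%:R / 2 ^+ q).
  move=> t0 [e /= e0 Qe]; have [p [q [tp pe]]] := dyadic_in_interval t0 e0.
  exists p, q; split=> //; apply: Qe => //=.
  by rewrite ltr_distlC; apply/andP; split; lra.
have dyadic_below (t : R) : 0 <= t ->
    exists p q : nat, t < p%:R / 2 ^+ q /\ f (p%:R / 2 ^+ q) < a.
  move=> t0; have [u tu fu] := fa t.
  have u0 : 0 <= u by exact: le_trans t0 (ltW tu).
  have [p [q [up fp]]] := right_nbhs (fun s => f s < a) u u0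
    (cvgr_lt _ (rc u u0) _ fu).
  by exists p, q; split=> //; exact: lt_trans up.
have dyadic_above (t : R) : 0 <= t ->
    exists p q : nat, t < p%:R / 2 ^+ q /\ b < f (p%:R / 2 ^+ q).
  move=> t0; have [u tu fu] := fb t.
  have u0 : 0 <= u by exact: le_trans t0 (ltW tu).
  have [p [q [up fp]]] := right_nbhs (fun s => b < f s) u u0
    (cvgr_gt _ (rc u u0) _ fu).
  by exists p, q; split=> //; exact: lt_trans up.
have pow0 n : 0 < 2 ^+ n :> R by rewrite exprn_gt0.
have indexE (p q n : nat) : (q <= n)%N ->
    (p * 2 ^ (n - q))%:R / 2 ^+ n = p%:R / 2 ^+ q :> R.
  move=> qn; rewrite natrM natrX -{2}(subnK qn) exprD invfM mulrA.
  by rewrite mulfK// gt_eqF.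
have index_lt (p q p' q' n : nat) : (q <= n)%N -> (q' <= n)%N ->
    p%:R / 2 ^+ q < p'%:R / 2 ^+ q' :> R ->
    (p * 2 ^ (n - q) < p' * 2 ^ (n - q'))%N.
  move=> qn qn'; rewrite -(indexE p q n)// -(indexE p' q' n)//.
  by rewrite ltr_pM2r ?invr_gt0// ltr_nat.
suff [p [q [N [qN UN]]]] : exists p q N : nat, (q <= N)%N /\
    forall n, (N <= n)%N ->
      (k <= upcrossings a b (dyadic_sample f n) (p * 2 ^ (n - q)))%N.
  exists (p * 2 ^ (N - q))%N, N => n Nn; apply: leq_trans (UN n Nn) _.
  by rewrite -mulnA -expnD addnC addnBA// subnK.
elim: k => [|k [p [q [N [qN IHk]]]]]; first by exists 0%N, 0%N, 0%N.
have dyadic0 (p' q' : nat) : 0 <= p'%:R / 2 ^+ q' :> R.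
  by rewrite divr_ge0// ltW.
have [p1 [q1 [lt1 f1]]] := dyadic_below _ (dyadic0 p q).
have [p2 [q2 [lt2 f2]]] := dyadic_above _ (dyadic0 p1 q1).
exists p2, q2, (maxn N (maxn q1 q2)); split; first by rewrite !leq_max leqnn !orbT.
move=> n; rewrite !geq_max => /and3P[Nn q1n q2n].
have qn := leq_trans qN Nn.
apply: leq_ltn_trans (IHk n Nn) _.
apply: (@leq_ltn_trans (upcrossings a b (dyadic_sample f n) (p1 * 2 ^ (n - q1)))).
  by apply: upcrossings_mono; apply: ltnW; exact: index_lt.
apply: upcrossings_lt; [|exact: index_lt|by rewrite /dyadic_sample indexE].
by apply: holding_below => //; rewrite /dyadic_sample indexE.
Qed.

Lemma upcrossings_unbounded {R : realType} (f : R -> R) (a b : R) :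
  a < b ->
  (forall t : R, 0 <= t -> f s @[s --> t^'+] --> f t) ->
  (forall t, exists2 u, t < u & f u < a) ->
  (forall t, exists2 u, t < u & b < f u) ->
  (upcrossings a b (dyadic_sample f n) (n * 2 ^ n))%:R%:E @[n --> \oo]
    --> (+oo%E : \bar R).
Proof.
move=> ab rc fa fb; apply/cvgeyPge => A.
have [p [q UN]] := dyadic_upcrossings (Num.trunc `|A|).+1 ab rc fa fb.
near=> n; rewrite lee_fin.
have /truncn_itv/andP[_ /ltW] : 0 <= `|A| by [].
move=> /(le_trans (ler_norm A))/le_trans; apply; rewrite ler_nat.
have qn : (q <= n)%N by near: n; exact: nbhs_infty_ge.
apply: leq_trans (UN n qn) _; apply: upcrossings_mono.
apply: leq_mul; first by near: n; exact: nbhs_infty_ge.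
by rewrite leq_exp2l// leq_subr.
Unshelve. all: by end_near.
Qed.

(** A bounded path that crosses no rational interval infinitely often converges:
    its limit is the supremum of its eventual lower bounds. *)
Lemma cvg_of_no_oscillation {R : realType} (f : R -> R) :
  (forall t : R, 0 <= t -> 0 <= f t <= 1) ->
  (forall a b : rat, ratr a < ratr b :> R ->
    ~ ((forall t, exists2 u, t < u & f u < ratr a) /\
       (forall t, exists2 u, t < u & ratr b < f u))) ->
  exists l : R, f t @[t --> +oo] --> l.
Proof.
move=> f01 nosc.
pose L := [set a : R | \forall t \near (pinfty_nbhs R), a <= f t].
have L0 : L 0.
  by near do rewrite (andP (f01 _ _)).1//; exact: nbhs_pinfty_ge.
have Lsup : has_sup L.
  split; first by exists 0.
  exists 1 => a La; near (pinfty_nbhs R) => t.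
  have t0 : 0 <= t by near: t; exact: nbhs_pinfty_ge.
  apply: (@le_trans _ _ (f t)); first by near: t.
  by case/andP: (f01 t t0).
exists (sup L); apply/cvgrPdist_le => e e0.
have e2 : 0 < e / 2 by rewrite divr_gt0.
have [a La ae] := sup_adherent e0 Lsup.
have [x /andP[x1 x2]] : exists q : rat, sup L < ratr q < sup L + e / 2.
  by have [q] := rat_in_itvoo (ltac:(lra) : sup L < sup L + e / 2); exists q.
have [y /andP[y1 y2]] : exists q : rat, sup L + e / 2 < ratr q < sup L + e.
  by have [q] := rat_in_itvoo (ltac:(lra) : sup L + e / 2 < sup L + e); exists q.
have xy : ratr x < ratr y :> R by lra.
have [t ft] : exists t, forall u, t < u -> f u <= ratr y.
  apply: contrapT => noty; apply: (nosc x y xy); split=> t.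
    apply: contrapT => notx.
    suff : L (ratr x) by move=> /(ub_le_sup Lsup.2); rewrite leNgt x1.
    exists t; split=> [|u tu]; first exact: num_real.
    by rewrite leNgt; apply/negP => fu; apply: notx; exists u.
  apply: contrapT => nott; apply: noty; exists t => u tu.
  by rewrite leNgt; apply/negP => fu; apply: nott; exists u.
near=> u.
have au : a <= f u by near: u.
have uy : f u <= ratr y by apply: ft; near: u; apply: nbhs_pinfty_gt; exact: num_real.
by rewrite ler_distlC; apply/andP; split; lra.
Unshelve. all: by end_near.
Qed.

(** * Bounded supermartingales in continuous time *)

(** Along the dyadic grids on [[0, n]], Fatou's lemma turns the upcrossing
    inequality into the almost sure finiteness of the inferior limit of the
    numbers of upcrossings, which excludes that a path oscillates. *)
Lemma no_oscillation_ae {R : realType} d (Omega : measurableType d)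
    (P : probability Omega R) (F : R -> set (set Omega)) (S : R -> Omega -> R)
    (a b : R) :
  usual_filtration P F -> adapted F S ->
  (forall t w, 0 <= t -> 0 <= S t w <= 1) ->
  (forall w t, 0 <= t -> S s w @[s --> t^'+] --> S t w) ->
  (forall s t A, 0 <= s -> s <= t -> F s A ->
    (\int[P]_(w in A) (S t w)%:E <= \int[P]_(w in A) (S s w)%:E)%E) ->
  a < b ->
  {ae P, forall w, ~ ((forall t, exists2 u, t < u & S u w < a) /\
                      (forall t, exists2 u, t < u & b < S u w))}.
Proof.
move=> [sF monoF _ _] adS S01 rcS superS ab.
have grid0 n k : 0 <= k%:R / 2 ^+ n :> R by rewrite divr_ge0// exprn_ge0.
have grid_le n j k : (j <= k)%N -> j%:R / 2 ^+ n <= k%:R / 2 ^+ n :> R.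
  by move=> jk; rewrite ler_pM2r ?ler_nat// invr_gt0 exprn_gt0.
pose U n w := (upcrossings a b (dyadic_sample (S^~ w) n) (n * 2 ^ n))%:R : R.
have mS t : 0 <= t -> measurable_fun setT (S t).
  by move=> t0 _ B mB; rewrite setTI; apply: (sF t t0).2; exact: adS.
have mU n : measurable_fun setT (U n).
  by apply: measurable_upcrossings => j; exact: mS.
have EU n : (\int[P]_w (U n w)%:E <= (`|a| / (b - a))%:E)%E.
  have ba : 0 < b - a by rewrite subr_gt0.
  rewrite mulrC EFinM lee_pdivlMl//.
  apply: (@expected_upcrossings_le _ _ _ _
    (fun k => F (k%:R / 2 ^+ n)) (fun k => S (k%:R / 2 ^+ n))) => //.
  - by move=> k; exact: sF.
  - by move=> j k jk; apply: monoF => //; exact: grid_le.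
  - by move=> k B mB; exact: adS.
  - by move=> k w; exact: S01.
  - by move=> k A FA; apply: superS => //; exact: grid_le.
have EliminfU : (\int[P]_w limn_einf (fun n => (U n w)%:E) < +oo)%E.
  apply: le_lt_trans (fatou _ _ _ _) _ => //.
  - by move=> n; exact/measurable_EFinP.
  - by move=> n w _; rewrite lee_fin.
  rewrite limn_einf_lim.
  apply: le_lt_trans (_ : _ <= (`|a| / (b - a))%:E)%E (ltry _).
  apply: lime_le; first exact: is_cvg_einfs.
  near=> n; apply: le_trans (EU n).
  by apply: ereal_inf_lbound; exists n => /=.
have : {ae P, forall w, setT w -> limn_einf (fun n => (U n w)%:E) \is a fin_num}.
  apply: integrable_ae => //; apply/integrableP; split.
    apply: measurableT_comp => //; apply: measurable_fun_limn_esup => n.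
    by apply: measurableT_comp => //; exact/measurable_EFinP.
  under eq_integral => w _.
    rewrite gee0_abs; last first.
      rewrite limn_einf_lim; apply: lime_ge; first exact: is_cvg_einfs.
      near=> n; apply: le_ereal_inf_tmp => _ [k /= _ <-].
      by rewrite lee_fin.
    over.
  exact: EliminfU.
apply: filterS => w /(_ I) fin [Sa Sb].
have := upcrossings_unbounded ab (rcS w) Sa Sb.
by move=> /cvg_limn_einf_sup[limU _]; rewrite /U limU in fin.
Unshelve. all: by end_near.
Qed.

(** The supermartingale convergence theorem. There are countably many intervals
    with rational endpoints, so almost surely none of them is crossed infinitely
    often. *)
Lemma supermartingale_cvg_ae {R : realType} d (Omega : measurableType d)
    (P : probability Omega R) (F : R -> set (set Omega)) (S : R -> Omega -> R) :
  usual_filtration P F -> adapted F S ->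
  (forall t w, 0 <= t -> 0 <= S t w <= 1) ->
  (forall w t, 0 <= t -> S s w @[s --> t^'+] --> S t w) ->
  (forall s t A, 0 <= s -> s <= t -> F s A ->
    (\int[P]_(w in A) (S t w)%:E <= \int[P]_(w in A) (S s w)%:E)%E) ->
  {ae P, forall w, exists l : R, S t w @[t --> +oo] --> l}.
Proof.
move=> usF adS S01 rcS superS.
pose osc (ab : rat * rat) w := ratr ab.1 < ratr ab.2 :> R ->
  ~ ((forall t, exists2 u, t < u & S u w < ratr ab.1) /\
     (forall t, exists2 u, t < u & ratr ab.2 < S u w)).
have : {ae P, forall w, forall n : nat,
    if unpickle n is Some ab then osc ab w else True}.
  apply/ae_foralln => n; case: (unpickle n) => [ab|]; last exact: aeW.
  have [ltab|leba] := ltP (ratr ab.1 : R) (ratr ab.2).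
    have := no_oscillation_ae usF adS S01 rcS superS ltab.
    by apply: filterS => w nosc _.
  by apply: aeW => w; rewrite /osc ltNge leba.
apply: filterS => w nosc; apply: cvg_of_no_oscillation => [t t0|a b ab].
  exact: S01.
by have := nosc (pickle (a, b)); rewrite pickleK => /(_ ab).
Qed.

(** * Linear functions on the arc *)

Section Geometry.
Context {R : realType}.
Implicit Types (b x y v : R * R) (r delta : R).

Lemma pairing_proj_tangent x p v : tangent x p ->
  pairing p (proj_tangent x v) = pairing p v.
Proof.
rewrite /tangent /pairing /proj_tangent /dot /= => xp.
have -> : p.1 * v.1 + p.2 * v.2 = p.1 * v.1 + p.2 * v.2
   - (x.1 * v.1 + x.2 * v.2) * (x.1 * p.1 + x.2 * p.2) by rewrite xp mulr0 subr0.
ring.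
Qed.

Lemma proj_tangent_tangent x v : circle x -> tangent x (proj_tangent x v).
Proof.
rewrite /circle /tangent /proj_tangent /dot /= => x1.
transitivity ((x.1 * v.1 + x.2 * v.2) * (1 - (x.1 ^+ 2 + x.2 ^+ 2))); first by ring.
by rewrite x1 subrr mulr0.
Qed.

Lemma dot_circle_le1 x y : circle x -> circle y -> dot x y <= 1.
Proof.
rewrite /circle /dot /= => x1 y1.
have := sqr_ge0 (x.1 - y.1); have := sqr_ge0 (x.2 - y.2).
rewrite !sqrrB; lra.
Qed.

(** The opposite of the gradient on the circle of the linear function [dot b]. *)
Definition descent b x : R * R := proj_tangent x (- b.1, - b.2).

(** The difference of the two sides is [dot b x * (1 - dot x y)]: on the half
    circle where [dot b] is nonnegative, it is concave with respect to the
    connection rule. *)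
Lemma pairing_descent_eta_le b x y : circle x -> circle y -> 0 <= dot b x ->
  pairing (descent b x) (eta x y) <= dot b x - dot b y.
Proof.
move=> cx cy bx0.
rewrite pairing_proj_tangent; last exact: proj_tangent_tangent.
rewrite -subr_ge0; set lhs := (X in 0 <= X).
have -> : lhs = dot b x * (x.1 ^+ 2 + x.2 ^+ 2 - dot x y).
  by rewrite /lhs /pairing /descent /proj_tangent /dot /=; ring.
by rewrite cx mulr_ge0// subr_ge0 dot_circle_le1.
Qed.

Lemma pairing_eta_diag p x : pairing p (eta x x) = 0.
Proof. by rewrite /pairing /eta /proj_tangent /dot /=; ring. Qed.

Lemma circle_arc_circle r x : circle_arc r x -> circle x.
Proof. by case=> theta [_ ->]; rewrite /circle /= cos2Dsin2. Qed.

Lemma dot_direction_arc_itv r delta x : `|delta| + r <= pi / 2 ->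
  circle_arc r x -> 0 <= dot (cos delta, sin delta) x <= 1.
Proof.
move=> dr [theta [thetar ->]].
have -> : dot (cos delta, sin delta) (cos theta, sin theta) = cos (theta - delta).
  by rewrite cosB /dot /= [cos delta * _]mulrC [sin delta * _]mulrC.
rewrite cos_le1 andbT cos_ge0_pihalf//.
have := ler_norm delta; have := ler_norm (- delta); rewrite normrN.
have := ler_norm theta; have := ler_norm (- theta); rewrite normrN => *.
by apply/andP; split; lra.
Qed.

(** This description of the arc makes it visibly closed. *)
Lemma circle_arcP r x : 0 <= r <= pi ->
  circle_arc r x <-> circle x /\ cos r <= x.1.
Proof.
move=> /andP[r0 rpi]; split.
  move=> xr; split; first exact: circle_arc_circle xr.
  case: xr => theta [thetar ->] /=; rewrite -(cos_norm theta) leNgt.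
  rewrite ltr_cos ?in_itv/= ?r0 ?normr_ge0 ?(le_trans thetar)//.
  by rewrite -leNgt.
rewrite /circle => -[cx xr].
have x1 : -1 <= x.1 <= 1.
  have : x.1 ^+ 2 <= 1 by have := sqr_ge0 x.2; rewrite -cx; lra.
  by move=> sq; apply/andP; split; nra.
have [/andP[a0 api] acosx] := acos_def x1.
have ar : acos x.1 <= r.
  rewrite leNgt; apply/negP => ra.
  by move: xr; rewrite leNgt -acosx ltr_cos ?ra// in_itv/= ?a0 ?r0.
have sinx : sin (acos x.1) = `|x.2|.
  by rewrite sin_acos// -cx [_ + x.2 ^+ 2]addrC addrK sqrtr_sqr.
have [x2|x2] := leP 0 x.2.
  exists (acos x.1); rewrite ger0_norm//; split=> //.
  by rewrite acosx sinx ger0_norm//; case: x {cx xr x1 a0 api acosx ar sinx x2}.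
exists (- acos x.1); rewrite normrN ger0_norm//; split=> //.
rewrite cosN sinN acosx sinx ltr0_norm// opprK.
by case: x {cx xr x1 a0 api acosx ar sinx x2}.
Qed.

End Geometry.

(** * The sums that define the integral of the descent direction *)

Lemma derive1n_trigonometric {R : realType} (u v : R) (n : nat) :
  exists u' v' : R, derive1n n (fun a => u * cos a + v * sin a) =
    (fun a => u' * cos a + v' * sin a).
Proof.
elim: n => [|n [u' [v' IHn]]]; first by exists u, v.
exists v', (- u'); rewrite derive1nS IHn; apply/funext => a.
rewrite derive1E (_ : (fun a => _) = u' \*: (@cos R) + v' \*: (@sin R)); last first.
  exact/funext.
apply: derive_val; apply: is_derive_eq.
rewrite /GRing.scale /=; ring.
Qed.

Lemma smooth_dot {R : realType} (b : R * R) : smooth_on_circle (dot b).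
Proof.
move=> n theta; rewrite /dot /=.
have [u [v ->]] := derive1n_trigonometric b.1 b.2 n.
by apply: derivableD; apply: derivableM.
Qed.

Lemma sum_telescope_stopped {R : realType} (f : R -> R) (c : nat -> R) (t : R) m :
  0 <= t -> c 0%N = 0 ->
  \sum_(i < m) (f (Num.min (c i) t) - f (Num.min (c i.+1) t)) =
    f 0 - f (Num.min (c m) t).
Proof.
move=> t0 c0; elim: m => [|m IHm].
  by rewrite big_ord0 c0 min_l// subrr.
by rewrite big_ord_recr /= IHm addrA subrK.
Qed.

(** As [s] is a point of the subdivision, each term is the same in both sums or
    vanishes in the second one; the terms that remain telescope. *)
Lemma eta_sum_descent_le {R : realType} d (Omega : measurableType d)
    (b : R * R) (X : R -> Omega -> R * R) (c : nat -> R) (j m : nat) (s t : R)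
    (w : Omega) :
  (forall u w, 0 <= u -> circle (X u w)) ->
  (forall u w, 0 <= u -> 0 <= dot b (X u w)) ->
  c 0%N = 0 -> {homo c : i k / (i <= k)%N >-> i <= k} ->
  s = c j -> s <= t -> t <= c m ->
  eta_sum X (fun u w => descent b (X u w)) m (fun i _ => c i) t w
    - eta_sum X (fun u w => descent b (X u w)) m (fun i _ => c i) s w
  <= dot b (X s w) - dot b (X t w).
Proof.
move=> cX bX c0 hc sE st tm.
have s0 : 0 <= s by rewrite sE -c0 hc.
have t0 : 0 <= t := le_trans s0 st.
have ci0 i : 0 <= c i by rewrite -c0 hc.
pose f u := dot b (X u w).
have -> : f s - f t = (f 0 - f (Num.min (c m) t)) - (f 0 - f (Num.min (c m) s)).
  by rewrite (min_r tm) (min_r (le_trans st tm)); ring.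
rewrite -!sum_telescope_stopped// -!sumrB /eta_sum; apply: ler_sum => i _.
have [ij|ji] := ltnP i j.
  have cs : c i.+1 <= s by rewrite sE hc.
  have cs' : c i <= s by apply: le_trans cs; exact: hc.
  by rewrite !min_l ?subrr// (le_trans _ st).
have sc : s <= c i by rewrite sE hc.
have sc' : s <= c i.+1 by apply: le_trans sc _; exact: hc.
rewrite (min_r sc) (min_r sc') pairing_eta_diag subrr !subr0.
by apply: pairing_descent_eta_le; [apply: cX|apply: cX|apply: bX];
  rewrite le_min ci0 t0.
Qed.

(** * The descent direction along a semimartingale on the circle *)

Section DescentProcess.
Context {R : realType} {d : measure_display} {Omega : measurableType d}.
Variables (P : probability Omega R) (F : R -> set (set Omega)).
Variables (X : R -> Omega -> R * R) (b : R * R).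
Hypotheses (usF : usual_filtration P F) (semiX : circle_semimartingale P F X).

Lemma adapted_dot v : adapted F (fun t w => dot v (X t w)).
Proof. by case: (semiX.2 _ (@smooth_dot _ v)). Qed.

Lemma cadlag_dot v : cadlag (fun t w => dot v (X t w)).
Proof. by case: (semiX.2 _ (@smooth_dot _ v)). Qed.

Lemma dot10 (x : R * R) : dot (1, 0) x = x.1.
Proof. by rewrite /dot /= mul1r mul0r addr0. Qed.

Lemma dot01 (x : R * R) : dot (0, 1) x = x.2.
Proof. by rewrite /dot /= mul1r mul0r add0r. Qed.

Lemma adapted_measurable d' (U : measurableType d') (Y : R -> Omega -> U) t :
  adapted F Y -> 0 <= t -> measurable_fun setT (Y t).
Proof.
case: usF => sF _ _ _ adY t0 _ B mB; rewrite setTI.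
by apply: (sF t t0).2; exact: adY.
Qed.

Lemma measurable_descent d' (T : measurableType d') (x : T -> R * R) :
  measurable_fun setT (fun w => (x w).1) ->
  measurable_fun setT (fun w => (x w).2) ->
  measurable_fun setT (fun w => descent b (x w)).
Proof.
move=> m1 m2.
have mdot : measurable_fun setT (fun w => dot (x w) (- b.1, - b.2)).
  by apply: measurable_funD; apply: measurable_funM.
by apply: measurable_fun_pair; apply: measurable_funB => //;
  apply: measurable_funM.
Qed.

Lemma cvg_descent (T : Type) (G : set_system T) (x : T -> R * R) (l : R * R) :
  Filter G -> (x t).1 @[t --> G] --> l.1 -> (x t).2 @[t --> G] --> l.2 ->
  descent b (x t) @[t --> G] --> descent b l.
Proof.
move=> FG x1 x2.
have cdot : dot (x t) (- b.1, - b.2) @[t --> G] --> dot l (- b.1, - b.2).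
  by apply: cvgD; apply: cvgM => //; exact: cvg_cst.
have c1 : (descent b (x t)).1 @[t --> G] --> (descent b l).1.
  by apply: cvgB; [exact: cvg_cst|exact: cvgM].
have c2 : (descent b (x t)).2 @[t --> G] --> (descent b l).2.
  by apply: cvgB; [exact: cvg_cst|exact: cvgM].
exact: (cvg_pair c1 c2).
Qed.

Lemma descent_process_above :
  cotangent_process_above F X (fun t w => descent b (X t w)).
Proof.
split.
- by move=> t w t0; apply: proj_tangent_tangent; exact: semiX.1.
- move=> t t0; case: usF => sF _ _ _.
  apply: (iffLR (measurable_fun_sigma_algebra (descent b \o X t) (sF t t0).1)).
  apply: measurable_descent.
    under eq_fun do rewrite -dot10.
    by apply/(measurable_fun_sigma_algebra _ (sF t t0).1); exact: adapted_dot.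
  under eq_fun do rewrite -dot01.
  by apply/(measurable_fun_sigma_algebra _ (sF t t0).1); exact: adapted_dot.
- move=> w; have [r1 l1] := @cadlag_dot (1, 0) w.
  have [r2 l2] := @cadlag_dot (0, 1) w.
  split=> t t0.
    apply: cvg_descent.
      by have := r1 t t0; under eq_fun do rewrite dot10; rewrite dot10.
    by have := r2 t t0; under eq_fun do rewrite dot01; rewrite dot01.
  have [u1] := l1 t t0; have [u2] := l2 t t0.
  under eq_fun do rewrite dot01; under [in X in _ -> X -> _]eq_fun do rewrite dot10.
  by move=> h2 h1; exists (descent b (u1, u2)); apply: cvg_descent.
Qed.

Lemma measurable_eta_sum (m : nat) (c : nat -> R) t :
  0 <= t -> (forall i, 0 <= c i) ->
  measurable_fun setT
    (eta_sum X (fun t w => descent b (X t w)) m (fun i _ => c i) t).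
Proof.
move=> t0 c0.
have mX1 u : 0 <= u -> measurable_fun setT (fun w => (X u w).1).
  move=> u0; under eq_fun do rewrite -dot10.
  by apply: (adapted_measurable (@adapted_dot _)).
have mX2 u : 0 <= u -> measurable_fun setT (fun w => (X u w).2).
  move=> u0; under eq_fun do rewrite -dot01.
  by apply: (adapted_measurable (@adapted_dot _)).
apply: measurable_sum => i.
have u0 k : 0 <= Num.min (c k) t by rewrite le_min c0 t0.
have mphi := measurable_descent (mX1 _ (u0 i)) (mX2 _ (u0 i)).
have mphi1 := measurableT_comp measurable_fst mphi.
have mphi2 := measurableT_comp measurable_snd mphi.
have mdx1 := measurable_funB (mX1 _ (u0 i.+1)) (mX1 _ (u0 i)).
have mdx2 := measurable_funB (mX2 _ (u0 i.+1)) (mX2 _ (u0 i)).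
have mdot := measurable_funD (measurable_funM (mX1 _ (u0 i)) mdx1)
  (measurable_funM (mX2 _ (u0 i)) mdx2).
apply: measurable_funD; apply: measurable_funM => //; apply: measurable_funB => //.
  by apply: measurable_funM => //; exact: mX1.
by apply: measurable_funM => //; exact: mX2.
Qed.

End DescentProcess.

(** * Limits in probability *)

Lemma cvg_in_probability_le {R : realType} d (Omega : measurableType d)
    (P : probability Omega R) (Y Y' : nat -> Omega -> R) (Z Z' D : Omega -> R) :
  (forall n, measurable_fun setT (Y n)) ->
  (forall n, measurable_fun setT (Y' n)) ->
  measurable_fun setT Z -> measurable_fun setT Z' -> measurable_fun setT D ->
  cvg_in_probability P Y Z -> cvg_in_probability P Y' Z' ->
  (\forall n \near \oo, forall w, Y n w - Y' n w <= D w) ->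
  {ae P, forall w, Z w - Z' w <= D w}.
Proof.
move=> mY mY' mZ mZ' mD YZ YZ' YD.
have dist_measurable (U V : Omega -> R) e : measurable_fun setT U ->
    measurable_fun setT V -> measurable [set w | e <= `|U w - V w|].
  move=> mU mV; rewrite -[X in measurable X]setTI.
  apply: measurable_fun_le => //; apply: measurableT_comp => //.
  exact: measurable_funB.
have small (e : R) : 0 < e -> {ae P, forall w, Z w - Z' w <= D w + e}.
  move=> e0; have e2 : 0 < e / 2 by rewrite divr_gt0.
  pose A := [set w | ~ (Z w - Z' w <= D w + e)].
  have mA : measurable A.
    rewrite [A](_ : _ = ~` [set w | Z w - Z' w <= D w + e])//.
    apply: measurableC; rewrite -[X in measurable X]setTI.
    apply: measurable_fun_le => //; first exact: measurable_funB.
    exact: measurable_funD.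
  exists A; split=> //; apply/eqP; rewrite eq_le measure_ge0 andbT.
  have lim0 : (P [set w | (e / 2 <= `|Y n w - Z w|)%R] +
      P [set w | (e / 2 <= `|Y' n w - Z' w|)%R])%E @[n --> \oo] --> 0%E.
    by rewrite -[0%E]adde0; apply: cvgeD => //; [exact: YZ|exact: YZ'].
  apply: (cvge_ge _ lim0).
  near=> n; apply: le_trans (measureU2 _ _ _); [|exact: dist_measurable..].
  apply: le_measure; rewrite ?inE//.
    by apply: measurableU; exact: dist_measurable.
  move=> w /= /negP; rewrite -ltNge => DZ.
  have YDw : Y n w - Y' n w <= D w by move: w {DZ}; near: n.
  have [|far] := leP (e / 2) `|Y n w - Z w|; [by left|right].
  rewrite leNgt; apply/negP => far'.
  move: far far'; rewrite !ltr_norml => /andP[? _] /andP[_ ?]; lra.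
have : {ae P, forall w, forall n : nat, Z w - Z' w <= D w + n.+1%:R^-1}.
  by apply/ae_foralln => n; apply: small; rewrite invr_gt0.
apply: filterS => w le_inv; apply/ler_addgt0Pr => e e0.
have [n _ /(_ n (leqnn n))] := near_infty_natSinv_lt (PosNum e0).
rewrite /= => /ltW ne; apply: le_trans (le_inv n) _.
by rewrite lerD2l.
Unshelve. all: by end_near.
Qed.

(** * Increments of the integral of the descent direction *)

Section Increments.
Context {R : realType} {d : measure_display} {Omega : measurableType d}.
Variables (P : probability Omega R) (F : R -> set (set Omega)).
Hypothesis usF : usual_filtration P F.

Lemma constant_stopping_time (u : R) : 0 <= u ->
  stopping_time F (EFin \o (fun=> u)).
Proof.
move=> u0; split=> [w|t t0] /=; first by rewrite lee_fin.
case: usF => sF _ _ _; have [[F0 FC _] _] := sF t t0.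
have [ut|tu] := leP u t.
  rewrite (_ : [set _ | _] = setT `\` set0); first exact: FC.
  by rewrite setD0; apply/seteqP; split=> w //= _; rewrite lee_fin.
rewrite (_ : [set _ | _] = set0)//; apply/seteqP; split=> w //=.
by rewrite lee_fin leNgt tu.
Qed.

(** The partitions have mesh [e / n.+1] and last time [n.+1 * e]; the time [e]
    belongs to all of them. *)
Definition uniform_time (e : R) (n i : nat) : R := i%:R * (e / n.+1%:R).

Lemma uniform_time_last e n :
  uniform_time e n (n.+1 * n.+1) = n.+1%:R * e.
Proof. by rewrite /uniform_time natrM -mulrA [_ * (e / _)]mulrC divfK. Qed.

Lemma uniform_time_homo e n : 0 < e ->
  {homo uniform_time e n : i k / (i <= k)%N >-> i <= k}.
Proof.
by move=> e0 i k ik; rewrite ler_pM2r ?ler_nat// divr_gt0.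
Qed.

Lemma near_uniform_time_last (e A : R) : 0 < e ->
  \forall n \near \oo, A <= uniform_time e n (n.+1 * n.+1).
Proof.
move=> e0; near=> n; rewrite uniform_time_last -ler_pdivrMr//.
apply: (@le_trans _ _ n%:R); last by rewrite ler_nat.
by near: n; exact: nbhs_infty_ger.
Unshelve. all: by end_near.
Qed.

Lemma uniform_random_partitions (e : R) : 0 < e ->
  random_partitions P F (fun n => (n.+1 * n.+1)%N)
    (fun n i _ => uniform_time e n i).
Proof.
move=> e0; have h0 n : 0 < e / n.+1%:R by rewrite divr_gt0.
split.
- move=> n i _; apply: constant_stopping_time.
  by rewrite mulr_ge0// ltW.
- by move=> n w; rewrite /uniform_time mul0r.
- by move=> n i w _; rewrite ltr_pM2r// ltr_nat.
- apply: aeW => w.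
  apply: (@squeeze_cvgr _ _ _ _ (fun=> 0) (fun n => e / n.+1%:R)).
  + apply: nearW => n; rewrite bigmax_ge_id/=.
    apply: bigmax_le => [|i _]; first exact: ltW.
    by rewrite /uniform_time -mulrBl -natrB// subSnn mul1r.
  + exact: cvg_cst.
  + rewrite -[X in _ --> X](mulr0 e).
    by apply: cvgM; [exact: cvg_cst|exact: cvg_harmonic].
- apply: aeW => w; apply/cvgryPge => A.
  exact: near_uniform_time_last.
Qed.

Variables (b : R * R) (X : R -> Omega -> R * R) (I : R -> Omega -> R).
Hypotheses (semiX : circle_semimartingale P F X)
  (bX : forall t w, 0 <= t -> 0 <= dot b (X t w)).
Hypothesis intI :
  is_eta_integral P F X (fun t w => descent b (X t w)) I.

(** The partitions are chosen to contain [s], so that the approximating sums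
    satisfy the same inequality. *)
Lemma integral_increment_le_ae s t : 0 <= s -> s <= t ->
  {ae P, forall w, I t w - I s w <= dot b (X s w) - dot b (X t w)}.
Proof.
move=> s0 st; have t0 := le_trans s0 st.
(* The time s is the point of index j n of the n-th partition. *)
pose e := if s == 0 then 1 else s.
have e0 : 0 < e by rewrite /e; case: eqVneq => // sN0; rewrite lt_def sN0.
pose j n := if s == 0 then 0%N else n.+1.
have sE n : s = uniform_time e n (j n).
  rewrite /uniform_time /j /e; case: eqP => [->|_]; first by rewrite mul0r.
  by rewrite mulrC divfK.
have [[adI _ _] cvgI] := intI.
have part := uniform_random_partitions e0.
have time0 n i : 0 <= uniform_time e n i by rewrite mulr_ge0// divr_ge0// ltW.
have mdot u : 0 <= u -> measurable_fun setT (fun w => dot b (X u w)).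
  exact: (adapted_measurable usF (@adapted_dot _ _ _ P F X semiX b)).
apply: (cvg_in_probability_le _ _ _ _ _ (cvgI _ _ part t t0) (cvgI _ _ part s s0)).
- by move=> n; apply: (measurable_eta_sum b usF semiX).
- by move=> n; apply: (measurable_eta_sum b usF semiX).
- exact: (adapted_measurable usF adI t0).
- exact: (adapted_measurable usF adI s0).
- by apply: measurable_funB; exact: mdot.
near=> n => w; apply: (@eta_sum_descent_le _ _ _ b X (uniform_time e n) (j n)) => //.
- exact: semiX.1.
- by rewrite /uniform_time mul0r.
- exact: uniform_time_homo.
- by near: n; exact: near_uniform_time_last.
Unshelve. all: by end_near.
Qed.

Lemma right_continuous_le (g : R -> R) :
  (forall t : R, 0 <= t -> g s @[s --> t^'+] --> g t) ->
  (forall p q : rat, 0 <= (ratr p : R) -> (ratr p : R) <= ratr q ->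
    g (ratr q) <= g (ratr p)) ->
  forall s t, 0 <= s -> s <= t -> g t <= g s.
Proof.
move=> rcg gQ s t s0; rewrite le_eqVlt => /predU1P[->//|st].
rewrite leNgt; apply/negP => gst.
have t0 : 0 <= t := le_trans s0 (ltW st).
have mid1 : g s < (g s + g t) / 2 by lra.
have mid2 : (g s + g t) / 2 < g t by lra.
have [e1 /= e10 near_s] := cvgr_lt _ (rcg s s0) _ mid1.
have [e2 /= e20 near_t] := cvgr_gt _ (rcg t t0) _ mid2.
have [p] : exists p : rat, ratr p \in `]s, (Num.min t (s + e1))[.
  by apply: rat_in_itvoo; rewrite lt_min st/= ltrDl.
rewrite in_itv/= lt_min => /and3P[sp pt pe].
have [q] : exists q : rat, ratr q \in `]t, (t + e2)[.
  by apply: rat_in_itvoo; rewrite ltrDl.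
rewrite in_itv/= => /andP[tq qe].
have := gQ p q (ltac:(lra)) (ltac:(lra)).
have : g (ratr p) < (g s + g t) / 2.
  by apply: near_s => //=; rewrite ltr_distlC; apply/andP; split; lra.
have : (g s + g t) / 2 < g (ratr q).
  by apply: near_t => //=; rewrite ltr_distlC; apply/andP; split; lra.
lra.
Qed.

Lemma integral_increments_le_ae : {ae P, forall w, forall s t, 0 <= s -> s <= t ->
  I t w - I s w <= dot b (X s w) - dot b (X t w)}.
Proof.
pose incr (pq : rat * rat) w := 0 <= (ratr pq.1 : R) ->
  (ratr pq.1 : R) <= ratr pq.2 ->
  I (ratr pq.2) w - I (ratr pq.1) w
    <= dot b (X (ratr pq.1) w) - dot b (X (ratr pq.2) w).
have : {ae P, forall w, forall n : nat,
    if unpickle n is Some pq then incr pq w else True}.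
  apply/ae_foralln => n; case: (unpickle n) => [pq|]; last exact: aeW.
  have [p0|p0] := leP 0 (ratr pq.1 : R); last first.
    by apply: aeW => w; rewrite /incr leNgt p0.
  have [pq'|pq'] := leP (ratr pq.1 : R) (ratr pq.2); last first.
    by apply: aeW => w; rewrite /incr (leNgt _ (ratr pq.2)) pq'.
  by apply: filterS (integral_increment_le_ae p0 pq') => w ? _ _.
apply: filterS => w incrQ s t s0 st.
have [[_ cadI _] _] := intI.
suff : I t w + dot b (X t w) <= I s w + dot b (X s w) by lra.
apply: (@right_continuous_le (fun u => I u w + dot b (X u w))) => //.
  move=> u u0; apply: cvgD; first exact: (cadI w).1.
  exact: (@cadlag_dot _ _ _ P F X semiX b w).1.
move=> p q p0 pq.
have := incrQ (pickle (p, q)); rewrite pickleK => /(_ p0 pq) /=; lra.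
Qed.

End Increments.

(** * Localisation *)

Section Localisation.
Context {R : realType} {d : measure_display} {Omega : measurableType d}.
Variables (P : probability Omega R) (F : R -> set (set Omega)).
Hypothesis usF : usual_filtration P F.

Lemma measurable_stopping_event (T : Omega -> \bar R) t : stopping_time F T ->
  0 <= t -> measurable [set w | (T w <= t%:E)%E].
Proof. by case: usF => sF _ _ _ [_ FT] t0; apply: (sF t t0).2; exact: FT. Qed.

Lemma localising_probability_cvg0 (T : nat -> Omega -> \bar R) t : 0 <= t ->
  (forall n, stopping_time F (T n)) ->
  {ae P, forall w, T n w @[n --> \oo] --> +oo%E} ->
  P [set w | (T n w <= t%:E)%E] @[n --> \oo] --> 0%E.
Proof.
move=> t0 stT Too; pose A n := [set w | (T n w <= t%:E)%E].
have mA n : measurable (A n) by exact: measurable_stopping_event.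
have [] := @dominated_convergence _ _ _ P setT measurableT
  (fun n w => (\1_(A n) w)%:E) (cst 0%E) (cst 1%E).
- by move=> n; apply/measurable_EFinP; exact: measurable_indic.
- exact: measurable_cst.
- apply: filterS Too => w Tw _; apply: cvg_near_cst.
  have : \forall n \near \oo, (t%:E < T n w)%E.
    by move/cvgeyPgt : Tw => /(_ t).
  apply: filterS => n tT; rewrite indicE memNset//= /A /=.
  by apply/negP; rewrite -ltNge.
- by apply: finite_measure_integrable_cst.
- by apply: aeW => w n _; rewrite gee0_abs ?lee_fin// indicE; case: (_ \in _).
move=> _ _; rewrite integral_cst// mul0e; apply: cvg_trans.
apply: near_eq_cvg; apply: nearW => n /=.
by rewrite integral_indic// setIT.
Qed.

(** A bounded process whose increments are dominated by those of minus a local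
    martingale is a supermartingale. Before the localising time the domination
    holds for the stopped processes; after it the increments of the bounded
    process are at most 1, so that the error is controlled by the probability
    of having been stopped. *)
Lemma supermartingale_of_local_martingale (S I : R -> Omega -> R) :
  adapted F S -> (forall t w, 0 <= t -> 0 <= S t w <= 1) ->
  local_martingale P F I ->
  {ae P, forall w, forall s t, 0 <= s -> s <= t ->
    I t w - I s w <= S s w - S t w} ->
  forall s t A, 0 <= s -> s <= t -> F s A ->
    (\int[P]_(w in A) (S t w)%:E <= \int[P]_(w in A) (S s w)%:E)%E.
Proof.
move=> adS S01 [_ _ [T [stT _ Too martT]]] IS s t A s0 st FA.
have t0 := le_trans s0 st.
have mA : measurable A by case: usF => sF _ _ _; exact: (sF s s0).2.
have mS u : 0 <= u -> measurable_fun setT (S u).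
  by move=> u0; exact: (adapted_measurable usF adS).
have intS u : 0 <= u -> P.-integrable A (EFin \o S u).
  move=> u0; apply: (@le_integrable _ _ _ P _ mA _ (cst 1%E)).
  - by apply/measurable_EFinP; apply: measurable_funTS; exact: mS.
  - move=> w _ /=; have /andP[S0 S1] := S01 u w u0.
    by rewrite !lee_fin normr1 ger0_norm.
  - exact: finite_measure_integrable_cst.
have bound n : (\int[P]_(w in A) (S t w)%:E <=
    \int[P]_(w in A) (S s w)%:E + 2%:E * P [set w | (T n w <= t%:E)%E])%E.
  pose M u w := stopped I (T n) u w - I 0 w.
  have [_ intM EM] := martT n.
  pose B := [set w | (T n w <= t%:E)%E].
  have mB : measurable B by exact: measurable_stopping_event.
  have intMA u : 0 <= u -> P.-integrable A (EFin \o M u).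
    by move=> u0; apply: integrableS (intM u u0).
  have intB : P.-integrable A (EFin \o (\1_B : Omega -> R)).
    by apply: integrableS (integrable_indic _ mB).
  (* Where the process is stopped before t, the increment of M is at most 1 and
     S s - S t is at least -1, whence the factor 2. *)
  pose G w := M s w + S s w + 2 * \1_B w - (M t w + S t w).
  have G0 : {ae P, forall w, 0 <= G w}.
    apply: filterS IS => w IS; rewrite subr_ge0 /M /stopped.
    have Tw := (stT n).1 w.
    have St := S01 t w t0; have Ss := S01 s w s0.
    have [Tt|tT] := leP (T n w) t%:E; last first.
      rewrite indicE memNset ?mulr0 ?addr0; last first.
        by apply/negP; rewrite -ltNge.
      have sT : (s%:E <= T n w)%E.
        by apply: ltW; apply: le_lt_trans tT; rewrite lee_fin.
      rewrite (min_l sT) /=.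
      by have := IS s t s0 st; lra.
    rewrite indicE mem_set// mulr1.
    have [v vE] : exists v, T n w = v%:E.
      by case: (T n w) Tw Tt => [v| |]//; exists v.
    rewrite vE -!EFin_min /=; rewrite vE lee_fin in Tw.
    have sv0 : 0 <= Num.min s v by rewrite le_min s0.
    have stv : Num.min s v <= v by rewrite ge_min lexx orbT.
    have /andP[_ ?] := S01 _ w sv0; have /andP[? _] := S01 _ w (le_trans sv0 stv).
    by have := IS _ _ sv0 stv; move/andP: St => [? ?]; move/andP: Ss => [? ?]; lra.
  have intMS u : 0 <= u -> P.-integrable A (EFin \o (M u \+ S u)).
    by move=> u0; apply: integrableD (intMA u u0) (intS u u0).
  have intB2 : P.-integrable A (EFin \o (fun w => 2 * \1_B w)).
    by apply: (integrableZl mA 2 intB).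
  have intMSB : P.-integrable A (EFin \o (fun w => M s w + S s w + 2 * \1_B w)).
    exact: integrableD (intMS s s0) intB2.
  have intG : P.-integrable A (EFin \o G).
    exact: integrableB intMSB (intMS t t0).
  have RG : 0 <= \int[P]_(w in A) G w.
    rewrite /Rintegral fine_ge0//.
    rewrite (@ae_eq_integral _ _ _ _ _ (fun w => (Num.max 0 (G w))%:E) _ mA).
    - by apply: integral_ge0 => w _; rewrite lee_fin le_max lexx.
    - by case/integrableP: intG.
    - apply/measurable_EFinP; apply: measurable_maxr; first exact: measurable_cst.
      by case/integrableP: intG => /measurable_EFinP.
    - by apply: filterS G0 => w Gw _; rewrite max_r.
  have EMR : \int[P]_(w in A) M t w = \int[P]_(w in A) M s w.
    by rewrite /Rintegral (EM s t s0 st A FA).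
  have EB : \int[P]_(w in A) \1_B w <= fine (P B).
    rewrite /Rintegral integral_indic// fine_le ?fin_num_measure//.
      exact: measurableI.
    by rewrite le_measure ?inE//; exact: measurableI.
  move: RG; rewrite /G RintegralB//; last exact: intMS.
  rewrite (RintegralD mA (intMS s s0) intB2).
  rewrite (RintegralD mA (intMA s s0) (intS s s0)).
  rewrite (RintegralD mA (intMA t t0) (intS t t0)) RintegralZl// EMR => RG.
  rewrite -(fineK (integrable_fin_num mA (intS t t0))).
  rewrite -(fineK (integrable_fin_num mA (intS s s0))).
  rewrite -(@fineK _ (P B)) ?fin_num_measure// -EFinM -EFinD lee_fin.
  by move: RG EB; rewrite /Rintegral /=; lra.
have lim : (\int[P]_(w in A) (S s w)%:E + 2%:E * P [set w | (T n w <= t%:E)%E])%E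
    @[n --> \oo] --> (\int[P]_(w in A) (S s w)%:E)%E.
  rewrite -[X in _ --> X]adde0; apply: cvgeD => //.
    by rewrite fin_num_adde_defl.
  - exact: cvg_cst.
  rewrite -(mule0 2%:E); apply: cvgeZl => //.
  exact: localising_probability_cvg0.
by apply: (cvge_ge _ lim); apply: nearW.
Qed.

End Localisation.

(** * Convergence on the arc *)

Lemma cvg_dot_direction_ae {R : realType} (d : measure_display)
    (Omega : measurableType d) (P : probability Omega R)
    (F : R -> set (set Omega)) (r delta : R) (X : R -> Omega -> R * R) :
  usual_filtration P F -> `|delta| + r <= pi / 2 ->
  eta_martingale P F X ->
  (forall t w, 0 <= t -> circle_arc r (X t w)) ->
  {ae P, forall w, exists l : R,
    dot (cos delta, sin delta) (X t w) @[t --> +oo] --> l}.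
Proof.
move=> usF dr [semiX intX] arcX; set b := (cos delta, sin delta).
have S01 t w : 0 <= t -> 0 <= dot b (X t w) <= 1.
  by move=> t0; apply: dot_direction_arc_itv dr _; exact: arcX.
have [I [intI locI]] := intX _ (descent_process_above b usF semiX).
have adS : adapted F (fun t w => dot b (X t w)).
  exact: (@adapted_dot _ _ _ P F X semiX b).
apply: (supermartingale_cvg_ae usF adS S01).
  by move=> w; exact: (@cadlag_dot _ _ _ P F X semiX b w).1.
apply: (supermartingale_of_local_martingale usF adS S01 locI).
apply: (integral_increments_le_ae usF semiX _ intI).
by move=> t w t0; case/andP: (S01 t w t0).
Qed.

Theorem proposition4p7 (R : realType) (d : measure_display)
    (Omega : measurableType d) (P : probability Omega R)
    (F : R -> set (set Omega)) (r : R) (X : R -> Omega -> R * R) :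
  usual_filtration P F ->
  0 < r -> r < pi / 2 ->
  eta_martingale P F X ->
  (forall t omega, 0 <= t -> circle_arc r (X t omega)) ->
  {ae P, forall omega, exists x : R * R,
    circle_arc r x /\ X t omega @[t --> +oo] --> x}.
Proof.
move=> usF r0 rpi etaX arcX.
(* With this angle the two directions make an angle at most r + delta < pi / 2
   with the points of the arc. *)
pose delta := (pi / 2 - r) / 2.
have delta0 : 0 < delta by rewrite /delta; lra.
have delta_pi : delta < pi / 2 by rewrite /delta; lra.
have cvg_plus : {ae P, forall w, exists l : R,
    dot (cos delta, sin delta) (X t w) @[t --> +oo] --> l}.
  by apply: (cvg_dot_direction_ae usF _ etaX arcX); rewrite gtr0_norm// /delta; lra.
have cvg_minus : {ae P, forall w, exists l : R,
    dot (cos (- delta), sin (- delta)) (X t w) @[t --> +oo] --> l}.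
  apply: (cvg_dot_direction_ae usF _ etaX arcX).
  by rewrite normrN gtr0_norm// /delta; lra.
have cosN0 : cos delta != 0.
  by rewrite gt_eqF// cos_gt0_pihalf//; apply/andP; split; lra.
have sinN0 : sin delta != 0.
  by rewrite gt_eqF// sin_gt0_pihalf//; apply/andP; split; lra.
apply: filterS2 cvg_plus cvg_minus => w [l lP] [l' l'P].
pose x := ((l + l') / (2 * cos delta), (l - l') / (2 * sin delta)).
have x1 : (X t w).1 @[t --> +oo] --> x.1.
  under eq_fun => t.
    rewrite (_ : (X t w).1 = (dot (cos delta, sin delta) (X t w) +
      dot (cos (- delta), sin (- delta)) (X t w)) / (2 * cos delta)); last first.
      by rewrite cosN sinN /dot /=; field.
    over.
  by apply: cvgM; [exact: cvgD|exact: cvg_cst].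
have x2 : (X t w).2 @[t --> +oo] --> x.2.
  under eq_fun => t.
    rewrite (_ : (X t w).2 = (dot (cos delta, sin delta) (X t w) -
      dot (cos (- delta), sin (- delta)) (X t w)) / (2 * sin delta)); last first.
      by rewrite cosN sinN /dot /=; field.
    over.
  by apply: cvgM; [exact: cvgB|exact: cvg_cst].
exists x; split; last first.
  rewrite (_ : X^~ w = fun t => ((X t w).1, (X t w).2)); last first.
    by apply/funext => t; case: (X t w).
  exact: (cvg_pair x1 x2).
have r_itv : 0 <= r <= pi by apply/andP; split; lra.
apply/(circle_arcP _ r_itv); split.
  rewrite /circle.
  have : (X t w).1 ^+ 2 + (X t w).2 ^+ 2 @[t --> +oo] --> x.1 ^+ 2 + x.2 ^+ 2.
    by apply: cvgD; rewrite !expr2; apply: cvgM.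
  move=> /(cvg_lim (@Rhausdorff R)) /= <-; apply: lim_near_cst => //.
  near=> t; apply: circle_arc_circle (arcX t w _).
  by near: t; exact: nbhs_pinfty_ge.
apply: (cvgr_to_ge x1).
near=> t; have t0 : 0 <= t by near: t; exact: nbhs_pinfty_ge.
by have [_ ->] := (circle_arcP (X t w) r_itv).1 (arcX t w t0).
Unshelve. all: by end_near.
Qed.
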